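(* Let $O$ be a cyclic operad with multiplication over a commutative ring $\Bbbk$, let $\overline{\mathcal C}^*(O)$ be its normalized cochain complex and $B$ the Connes normalized coboundary map. The bilinear map of degree $-1$ $$Z:\overline{\mathcal C}^m(O)\otimes\overline{\mathcal C}^n(O)\to\overline{\mathcal C}^{m+n-1}(O),\qquad Z(f,g):=(-1)^{mn}\sum_{j=1}^m(-1)^{j(m+n-1)}\tau_{m+n-1}^{-j}\sigma_{m+n}(g\cup f)$$ satisfies $$B(f\cup g)=Z(f,g)+(-1)^{mn}Z(g,f),\qquad\forall f\in\overline{\mathcal C}^m(O),\ g\in\overline{\mathcal C}^n(O).$$
   Context: **Operads.** Operad means non-$\Sigma$ operad in $\Bbbk$-modules: modules $O(n)$, $n\in\mathbb N$ (including $n=0$), an element $id\in O(1)$, and structure maps $\gamma:O(n)\otimes O(i_1)\otimes\cdots\otimes O(i_n)\to O(i_1+\cdots+i_n)$ satisfying associativity and unit. For $f\in O(m)$, $g\in O(n)$, $1\le i\le m$, put $f\circ_ig:=\gamma(f;id,\dots,g,\dots,id)\in O(m+n-1)$ ($g$ in $i$-th place). An operad with multiplication is an operad with elements $\mu\in O(2)$, $e\in O(0)$ such that $\mu\circ_1\mu=\mu\circ_2\mu$ and $\mu\circ_1e=id=\mu\circ_2e$. A cyclic operad is an operad $O$ with linear maps $\tau_n:O(n)\to O(n)$, $n\in\mathbb N$, such that $\tau_n^{n+1}=\mathrm{id}$; for $m,n\ge1$, $\tau_{m+n-1}(f\circ_1g)=\tau_ng\circ_n\tau_mf$; and for $m\ge2$,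 $n\ge0$, $2\le i\le m$, $\tau_{m+n-1}(f\circ_ig)=\tau_mf\circ_{i-1}g$ (for all $f\in O(m)$, $g\in O(n)$). A cyclic operad with multiplication is an operad which is both an operad with multiplication and a cyclic operad, such that $\tau_2\mu=\mu$. **Notation.** For $f\in O(m)$, $g\in O(n)$, $f\cup g:=(\mu\circ_1f)\circ_{m+1}g\in O(m+n)$. Codegeneracies: $\sigma_{i-1}:O(n)\to O(n-1)$, $\sigma_{i-1}f=f\circ_ie$ for $1\le i\le n$. Extra degeneracy: $\sigma_n:=\sigma_{n-1}\tau_n:O(n)\to O(n-1)$ for $n\ge1$. Normalized cochains: $\overline{\mathcal C}^n(O)=\{f\in O(n):\sigma_jf=0,\ 0\le j\le n-1\}$, with $\overline{\mathcal C}^{i}(O)=0$ for $i<0$. Connes normalized coboundary: $B:=\sum_{i=0}^{n-1}(-1)^{i(n-1)}\tau_{n-1}^i\,\sigma_n:\overline{\mathcal C}^n(O)\to\overline{\mathcal C}^{n-1}(O)$ for $n\ge1$, and $B=0$ for $n=0$. *)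

(* Defs.v *)
From HB Require Import structures.
From mathcomp Require Import all_boot all_order all_algebra.

Set Implicit Arguments.
Unset Strict Implicit.
Unset Printing Implicit Defensive.

Import GRing.Theory.
Local Open Scope ring_scope.

Lemma sum_arity1 n : (\sum_(j < 1) n = n)%N.
Proof. by rewrite big_ord1. Qed.

Lemma sum_arity_id n : (\sum_(j < n) 1 = n)%N.
Proof. by rewrite sum1_card card_ord. Qed.

Lemma sum_arityA n (i : 'I_n -> nat) (d : 'I_(\sum_(j < n) i j)%N -> nat) :
  (\sum_(s < \sum_(j < n) i j) d s =
   \sum_(j < n) \sum_(l < i j) d (tagnat.Rank j l))%N.
Proof.
rewrite sig_big_dep /=.
rewrite (reindex (@tagnat.rank n i)) /=; last exact: tagnat.rank_bij_on.
by apply: eq_bigr => p _; rewrite tagnat.rankE.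
Qed.

(* Non-symmetric operads. Multilinearity of gamma encodes its being defined on
   the tensor product. In associativity the operations h_(j,l) plugged into
   g_j are listed in lexicographic order as a single family h, the one in
   position (j,l) being h (tagnat.Rank j l). *)
Record operad (k : comPzRingType) := Operad {
  ops :> nat -> lmodType k;
  opid : ops 1%N;
  gamma : forall n (i : 'I_n -> nat),
    ops n -> (forall j, ops (i j)) -> ops (\sum_(j < n) i j)%N;
  gamma_linearl : forall n (i : 'I_n -> nat) (g : forall j, ops (i j)),
    linear (fun f : ops n => gamma f g);
  gamma_linearr : forall n (i : 'I_n -> nat) (f : ops n)
      (g : forall j, ops (i j)) (j : 'I_n),
    linear (fun x : ops (i j) => gamma f (dfwith g x));
  gammaA : forall n (i : 'I_n -> nat) (d : 'I_(\sum_(j < n) i j)%N -> nat)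
      (f : ops n) (g : forall j, ops (i j)) (h : forall s, ops (d s)),
    ecast p (ops p) (sum_arityA d) (gamma (gamma f g) h) =
    gamma f (fun j => gamma (g j) (fun l => h (tagnat.Rank j l)));
  gamma1l : forall n (g : ops n),
    ecast p (ops p) (sum_arity1 n) (gamma opid (fun=> g)) = g;
  gamma1r : forall n (f : ops n),
    ecast p (ops p) (sum_arity_id n) (gamma f (fun=> opid)) = f
}.

Definition ocast (k : comPzRingType) (O : operad k) p q (e : p = q)
  (f : O p) : O q := ecast p (O p) e f.

Lemma circ_arity m n i : (0 < i <= m)%N ->
  (\sum_(j < m) (if j.+1 == i then n else 1) = (m + n).-1)%N.
Proof.
case: i => // i lt_im; rewrite (bigD1 (Ordinal lt_im)) //= eqxx.
rewrite (eq_bigr (fun=> 1%N)); last by move=> j /negPf; rewrite eqSS -val_eqE /= => ->.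
rewrite sum1_card -subn1 addnC -addnBAC; last by case: m lt_im.
by rewrite cardC1 card_ord subn1.
Qed.

(* Partial composition, with inputs numbered from 1: the junk value 0 is taken
   only when i is not in {1, ..., m}. *)
Definition circ (k : comPzRingType) (O : operad k) m n (f : O m) (i : nat)
    (g : O n) : O (m + n)%N.-1 :=
  if @idP (0 < i <= m)%N is ReflectT le_im then
    ocast (circ_arity n le_im)
      (gamma f (fun j : 'I_m =>
        if j.+1 == i as b return O (if b then n else 1%N) then g else opid O))
  else 0.

Notation "f \circ_[ i ] g" := (circ f i g)
  (at level 40, i at level 99, format "f  \circ_[ i ]  g") : ring_scope.

Lemma circE (k : comPzRingType) (O : operad k) m n (f : O m) i (g : O n)
    (le_im : (0 < i <= m)%N) :
  f \circ_[i] g = ocast (circ_arity n le_im)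
    (gamma f (fun j : 'I_m =>
      if j.+1 == i as b return O (if b then n else 1%N) then g else opid O)).
Proof.
by rewrite /circ; case: {-}_ / idP => // le_im'; rewrite (bool_irrelevance le_im' le_im).
Qed.

Record multiplication (k : comPzRingType) (O : operad k) := Multiplication {
  mu : O 2%N;
  unitop : O 0%N;
  muA : mu \circ_[1] mu = mu \circ_[2] mu;
  mu1l : mu \circ_[1] unitop = opid O;
  mu1r : mu \circ_[2] unitop = opid O
}.

Record cyclic_structure (k : comPzRingType) (O : operad k) := CyclicStructure {
  tau : forall n, {linear O n -> O n};
  tau_order : forall n (f : O n), iter n.+1 (tau n) f = f;
  tau_circ1 : forall m n (f : O m) (g : O n), (1 <= m)%N -> (1 <= n)%N ->
    tau (m + n)%N.-1 (f \circ_[1] g) =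
    ocast (congr1 predn (addnC n m)) (tau n g \circ_[n] tau m f);
  tau_circ : forall m n i (f : O m) (g : O n), (2 <= m)%N -> (2 <= i <= m)%N ->
    tau (m + n)%N.-1 (f \circ_[i] g) = tau m f \circ_[i.-1] g
}.

Record cyclic_operad_mult (k : comPzRingType) := CyclicOperadMult {
  com_operad :> operad k;
  com_mult : multiplication com_operad;
  com_cyclic : cyclic_structure com_operad;
  tau_mu : tau com_cyclic 2%N (mu com_mult) = mu com_mult
}.

Section CyclicOperadMult.
Variables (k : comPzRingType) (O : cyclic_operad_mult k).

Definition cyc n : {linear O n -> O n} := tau (com_cyclic O) n.
Definition cycV n (f : O n) : O n := iter n (cyc n) f.

Lemma cycK n : cancel (cyc n) (@cycV n).
Proof. by move=> f; rewrite /cycV -iterSr tau_order. Qed.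

Lemma cycVK n : cancel (@cycV n) (cyc n).
Proof. by move=> f; rewrite /cycV -iterS tau_order. Qed.

(* The ascription is by conversion: the two partial compositions land in
   O (2 + m).-1 and O (m.+1 + n).-1. *)
Definition cup m n (f : O m) (g : O n) : O (m + n)%N :=
  ((mu (com_mult O) \circ_[1] f : O m.+1) \circ_[m.+1] g).

(* Codegeneracies O(n) -> O(n-1), for 0 <= j <= n-1. *)
Definition codeg n (j : nat) (f : O n) : O n.-1 :=
  ocast (congr1 predn (addn0 n)) (f \circ_[j.+1] unitop (com_mult O)).

(* The extra codegeneracy sigma_n on O(n), for n >= 1. *)
Definition extra_codeg n (f : O n) : O n.-1 := codeg n.-1 (cyc n f).

Definition normalized n : {pred O n} :=
  [pred f : O n | [forall j : 'I_n, codeg j f == 0]].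

(* Normalized cochains of degree N - 1, as a subset of O(N.-1); in degree
   -1 (N = 0) this is the zero module. *)
Definition normalized_pred N : {pred O N.-1} :=
  if N is N'.+1 then @normalized N' else pred1 0.

(* For n = 0 this is an empty sum, that is 0. *)
Definition connesB n (f : O n) : O n.-1 :=
  \sum_(0 <= i < n) (-1) ^+ (i * n.-1) *: iter i (cyc n.-1) (extra_codeg f).

Definition Zmap m n (f : O m) (g : O n) : O (m + n)%N.-1 :=
  (-1) ^+ (m * n) *: \sum_(1 <= j < m.+1) (-1) ^+ (j * (m + n).-1) *:
    iter j (@cycV (m + n)%N.-1) (extra_codeg (ocast (addnC n m) (cup g f))).

End CyclicOperadMult.

Arguments normalized {k} O n _.
Arguments normalized_pred {k} O N _.

(* Main.v *)
Require Import Defs.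
From mathcomp Require Import all_boot all_order all_algebra.
From mathcomp Require Import zify.
From Stdlib Require Import FunctionalExtensionality.

(** The formula for B (f \cup g) is a splitting of one sum over rotations.
    Put N = m + n and X = sigma_N (f \cup g), an element of O (N - 1), so that
    B (f \cup g) is the sum over 0 <= i < N of
    (-1)^(i (N - 1)) tau^i X.

    The first m terms are Z (f, g). Rotating mu (f, g) once and feeding the unit
    into the freed slot of mu gives X = tau f \circ_m g when m > 0
    ([extra_cup]). Each of the next m - 1 rotations moves g one slot to the left,
    and, if n > 0, one more moves the root from f to g, which yields
    tau g \circ_n f = sigma_N (g \cup f); if n = 0, both sigma_N (g \cup f) and
    tau^m X are tau f \circ_m g. Hence sigma_N (g \cup f) = tau^m X
    ([extra_cupC]), and the term tau^(-j) sigma_N (g \cup f) of Z (f, g) is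
    tau^(m - j) X. The last n terms are (-1)^(mn) Z (g, f): the term
    tau^(-j) X is tau^(N - j) X because tau has order N on O (N - 1). The signs
    agree since m (N - 1) and mn have the same parity, and N (N - 1) is even.

    The value Z (f, g) is normalized when f and g are. By the above, its terms
    are tau^(i+1) f \circ_(m-i) g with i < m. A unit plugged into g gives
    0; plugged into another input of tau^(i+1) f it corresponds, after rotating
    back, to a unit plugged into an input of f, and gives 0 too. The only slot
    that would correspond to the root of f is the one which g occupies
    ([tzero_iter_codeg]).

    All identities between partial compositions are proved for operations
    packed with their arity, so that they hold without transport along equalities
    of arities. *)

Set Implicit Arguments.
Unset Strict Implicit.
Unset Printing Implicit Defensive.

Import GRing.Theory.
Local Open Scope ring_scope.

(** * Partial compositions in an operad *)

Section Packed.
Variables (k : comPzRingType) (O : operad k).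

(** Equality in this sum type compares operations whose arities are only provably
    equal; below, the prefix t marks the packed version of an operadic notion. *)
Definition operation := {p & O p}.
Definition pack p (f : O p) : operation := Tagged (ops O) f.

Lemma pack_inj p : injective (@pack p).
Proof. by move=> f g; apply: eq_from_Tagged. Qed.

Lemma pack_ocast p q (e : p = q) (f : O p) : pack (ocast e f) = pack f.
Proof. by case: q / e. Qed.

Definition tgamma (f : operation) (G : 'I_(tag f) -> operation) : operation :=
  pack (gamma (tagged f) (fun j => tagged (G j))).

Definition tcirc (f : operation) i (g : operation) : operation :=
  pack (tagged f \circ_[i] tagged g).

Definition tid : operation := pack (opid O).

Lemma tcirc_pack m n (f : O m) i (g : O n) :
  tcirc (pack f) i (pack g) = pack (f \circ_[i] g).
Proof. by []. Qed.

Lemma tag_tcirc f i g : tag (tcirc f i g) = (tag f + tag g).-1.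
Proof. by []. Qed.

(** In this form both branches have the same type, unlike the dependent
    conditional in [circ], so that composites can be compared slot by slot. *)
Lemma tcircE f i g : (0 < i <= tag f)%N ->
  tcirc f i g = tgamma (fun j : 'I_(tag f) => if j.+1 == i then g else tid).
Proof.
case: f g => [m f] [n g] /= le_im.
rewrite /tcirc (circE _ _ le_im) pack_ocast /tgamma /=.
pose a b := if b then n else 1%N.
pose u b := if b as b return O (a b) then g else opid O.
pose v b := if b then pack g else tid.
have E : (fun b => Tagged (ops O) (u b)) = v by apply: functional_extensionality; case.
by rewrite -[LHS]/(tgamma (f := pack f) (fun j => Tagged (ops O) (u (j.+1 == i))))
  -[RHS]/(tgamma (f := pack f) (fun j => v (j.+1 == i))) -E.
Qed.

(** [gamma] takes genuine functions, on which the operad axioms impose nothing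
    up to pointwise equality; this is where functional extensionality enters. *)
Lemma eq_tgamma f (G H : 'I_(tag f) -> operation) : G =1 H -> tgamma G = tgamma H.
Proof. by move=> /functional_extensionality ->. Qed.

Lemma tgammaA f (G : 'I_(tag f) -> operation)
    (H : 'I_(\sum_(j < tag f) tag (G j))%N -> operation) :
  tgamma (f := tgamma G) H =
  tgamma (fun j => tgamma (fun l : 'I_(tag (G j)) => H (tagnat.Rank j l))).
Proof.
have /(congr1 (@pack _)) :=
  gammaA (tagged f) (fun j => tagged (G j)) (fun s => tagged (H s)).
by rewrite -/(ocast _ _) pack_ocast.
Qed.

Lemma tgamma_idl (G : 'I_1 -> operation) : tgamma (f := tid) G = G ord0.
Proof.
rewrite (_ : G = (fun=> G ord0)); last first.
  by apply: functional_extensionality => j; rewrite (ord1 j).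
case: (G ord0) => n g.
by have /(congr1 (@pack _)) := gamma1l g; rewrite -/(ocast _ _) pack_ocast.
Qed.

Lemma tgamma_idr f : tgamma (fun _ : 'I_(tag f) => tid) = f.
Proof.
case: f => n f.
by have /(congr1 (@pack _)) := gamma1r f; rewrite -/(ocast _ _) pack_ocast.
Qed.

Lemma tcirc_idl f : tcirc tid 1 f = f.
Proof. by rewrite tcircE // tgamma_idl. Qed.

(** The position at which the inputs of the operation grafted at input a begin:
    those before a contribute one input each, except for g at input i. *)
Lemma sum_tag_before m i (g : operation) (a : 'I_m) : (0 < i)%N ->
  (\sum_(b < m | b < a) tag (if b.+1 == i then g else tid) =
   if i <= a then a.-1 + tag g else a)%N.
Proof.
move=> i_gt0; pose F b := tag (if b.+1 == i then g else tid).
rewrite -(big_ord_widen m F) ?(ltnW (ltn_ord a)) // {}/F.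
elim: (nat_of_ord a) => [|b IH]; first by rewrite big_ord0; case: i i_gt0.
rewrite big_ord_recr /= {}IH.
rewrite [tag (if _ then _ else _)]fun_if.
by case: eqP; do 2![case: ifP]; rewrite /=; lia.
Qed.

Lemma rank_tcirc m i (g : operation) (a : 'I_m)
    (l : 'I_(tag (if a.+1 == i then g else tid))) : (0 < i)%N ->
  tagnat.Rank (p_ := fun b : 'I_m => tag (if b.+1 == i then g else tid)) a l =
  ((if i <= a then a.-1 + tag g else a) + l)%N :> nat.
Proof. by move=> i_gt0; rewrite [LHS]tagnat.RankEsum sum_tag_before. Qed.

(** Composition into f \circ_i g is carried out inside f: the inputs of g are
    numbered i - 1, ..., i - 1 + tag g - 1 from 0, and those of f beyond i are
    shifted accordingly. Both partial associativity laws follow by comparing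
    the families that are plugged into f. *)
Lemma tgamma_tcirc f i g (H : nat -> operation) : (0 < i <= tag f)%N ->
  tgamma (fun s : 'I_(tag (tcirc f i g)) => H s) =
  tgamma (fun a : 'I_(tag f) =>
    if a.+1 == i then tgamma (fun l : 'I_(tag g) => H (i.-1 + l)%N)
    else H (if i <= a then a.-1 + tag g else a)%N).
Proof.
move=> le_if; rewrite tcircE // tgammaA; apply: eq_tgamma => a.
have i_gt0 : (0 < i)%N by case/andP: le_if.
transitivity (tgamma (f := if a.+1 == i then g else tid)
   (fun l => H ((if i <= a then a.-1 + tag g else a) + l)%N)).
  by apply: eq_tgamma => l; rewrite rank_tcirc.
case: eqP => [<-|_]; first by rewrite ltnn.
by rewrite tgamma_idl addn0.
Qed.

Lemma tcircA f i g j h : (0 < i <= tag f)%N -> (0 < j <= tag g)%N ->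
  tcirc (tcirc f i g) (i.-1 + j) h = tcirc f i (tcirc g j h).
Proof.
move=> le_if le_jg; rewrite tcircE; last by rewrite tag_tcirc; lia.
rewrite (tgamma_tcirc _ (fun s => if s.+1 == (i.-1 + j)%N then h else tid)) //.
rewrite (tcircE (tcirc g j h)) //; apply: eq_tgamma => a.
case: eqP => ai.
  rewrite tcircE //; apply: eq_tgamma => l.
  by congr (if _ then _ else _); lia.
by case: ifP => // ; case: ifP; lia.
Qed.

Lemma tcircC f i g j h : (0 < i < j)%N -> (j <= tag f)%N ->
  tcirc (tcirc f i g) (j.-1 + tag g) h = tcirc (tcirc f j h) i g.
Proof.
move=> lt_ij le_jf.
have [le_if le_jf'] : (0 < i <= tag f)%N /\ (0 < j <= tag f)%N by lia.
rewrite tcircE; last by rewrite tag_tcirc; lia.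
rewrite (tgamma_tcirc _ (fun s => if s.+1 == (j.-1 + tag g)%N then h else tid)) //.
rewrite tcircE; last by rewrite tag_tcirc; lia.
rewrite (tgamma_tcirc _ (fun s => if s.+1 == i then g else tid)) //.
apply: eq_tgamma => a; case: (a.+1 =P i) => ai; case: (a.+1 =P j) => aj; try lia.
- rewrite (_ : (j <= a)%N = false); last by lia.
  rewrite ai eqxx -[RHS]tgamma_idr; apply: eq_tgamma => l.
  by case: eqP => //; have := ltn_ord l; lia.
- rewrite (_ : (i <= a)%N = true); last by lia.
  rewrite (_ : _ == _ = true); last by lia.
  rewrite -[LHS]tgamma_idr; apply: eq_tgamma => l.
  by case: eqP => //; lia.
by do 4![case: ifP] => //; lia.
Qed.


Lemma ocast_linear p q (e : p = q) : linear (@ocast k O p q e).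
Proof. by case: q / e. Qed.

Lemma circ_out m n (f : O m) i (g : O n) : ~~ (0 < i <= m)%N ->
  f \circ_[i] g = 0.
Proof.
by move=> out; rewrite /circ; case: {-}_ / idP => // le_im; case/negP: out.
Qed.

Lemma circ_linearl m n i (g : O n) : linear (fun f : O m => f \circ_[i] g).
Proof.
move=> a f f'; have [le_im|out] := boolP (0 < i <= m)%N.
  by rewrite !circE gamma_linearl ocast_linear.
by rewrite !circ_out // scaler0 addr0.
Qed.

(** Linearity of [gamma] in one slot is stated through [dfwith], so the family
    defining [circ] is first recognised as a [dfwith] at input i. *)
Lemma circ_linearr m n i (f : O m) : linear (fun g : O n => f \circ_[i] g).
Proof.
move=> a g g'; have [le_im|out] := boolP (0 < i <= m)%N; last first.
  by rewrite !circ_out // scaler0 addr0.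
have lt_im : (i.-1 < m)%N by case: i le_im.
pose j0 := Ordinal lt_im.
have ej0 : (j0.+1 == i) by rewrite /= prednK //; case/andP: le_im.
pose fam (x : O n) (j : 'I_m) :=
  if j.+1 == i as b return O (if b then n else 1%N) then x else opid O.
have famE x : fam x = dfwith (fam 0) (fam x j0).
  apply: functional_extensionality_dep => j; rewrite /dfwith.
  case: eqP => [e|ne]; first by case: j / e.
  have /negPf : j.+1 != i.
    by apply/eqP => ji; apply: ne; apply: val_inj; rewrite /= -ji.
  by rewrite /fam; move: (j.+1 == i) => b ->.
have famL : fam (a *: g + g') j0 = a *: fam g j0 + fam g' j0.
  by rewrite /fam; move: (j0.+1 == i) ej0 => b ->.
rewrite !circE -ocast_linear; congr ocast.
by rewrite -/(fam _) (famE (a *: g + g')) famL gamma_linearr -!famE.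
Qed.

(** Vanishing is a predicate, rather than equality with a packed zero, so that no
    arity has to be computed. *)
Definition tzero (x : operation) := tagged x = 0.

Lemma tzero_tcircl f i g : tzero f -> tzero (tcirc f i g).
Proof.
rewrite /tzero /= => ->.
have := circ_linearl i (tagged g) (-1) 0 (0 : O (tag f)).
by rewrite scaler0 addr0 scaleN1r addNr.
Qed.

Lemma tzero_tcircr f i g : tzero g -> tzero (tcirc f i g).
Proof.
rewrite /tzero /= => ->.
have := circ_linearr i (tagged f) (-1) 0 (0 : O (tag g)).
by rewrite scaler0 addr0 scaleN1r addNr.
Qed.

End Packed.

(** * Rotations, units and cup products *)

Section Cyclic.
Variables (k : comPzRingType) (O : cyclic_operad_mult k).
Implicit Types f g h x : operation O.

Definition ttau x : operation O := pack (cyc O (tag x) (tagged x)).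
Definition te : operation O := pack (unitop (com_mult O)).
Definition tmu : operation O := pack (mu (com_mult O)).
Definition tcup f g := tcirc (tcirc tmu 1 f) (tag f).+1 g.
Definition textra x := tcirc (ttau x) (tag x).-1.+1 te.

Lemma iter_ttau n (f : O n) i : iter i ttau (pack f) = pack (iter i (cyc O n) f).
Proof. by elim: i => //= i ->. Qed.

Lemma tag_iter_ttau i x : tag (iter i ttau x) = tag x.
Proof. by case: x => n f; rewrite iter_ttau. Qed.

Lemma iter_ttau_order x : iter (tag x).+1 ttau x = x.
Proof. by case: x => n f; rewrite iter_ttau tau_order. Qed.

Lemma cycV0 n : cycV (0 : O n) = 0.
Proof. by rewrite /cycV iter_fix ?linear0. Qed.

Lemma tzero_iter_ttau i x : tzero (iter i ttau x) <-> tzero x.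
Proof.
elim: i => //= i <-; rewrite /tzero /=; split=> [|->]; last by rewrite linear0.
by move/(congr1 (@cycV _ _ _)); rewrite cycK cycV0.
Qed.

Lemma ttau_circ1 f g : (0 < tag f)%N -> (0 < tag g)%N ->
  ttau (tcirc f 1 g) = tcirc (ttau g) (tag g) (ttau f).
Proof.
move=> f0 g0; have /(congr1 (@pack _ _ _)) :=
  tau_circ1 (com_cyclic O) (tagged f) (tagged g) f0 g0.
by rewrite pack_ocast.
Qed.

Lemma ttau_circ f i g : (1 < i <= tag f)%N ->
  ttau (tcirc f i g) = tcirc (ttau f) i.-1 g.
Proof.
move=> /andP[i1 le_if]; apply: (congr1 (@pack _ _ _)); apply: tau_circ.
  exact: leq_trans le_if.
by rewrite i1.
Qed.

(** Rotating moves the slot of g one step to the left, as long as it does not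
    reach the root. *)
Lemma iter_ttau_circ f j g i : (i < j <= tag f)%N ->
  iter i ttau (tcirc f j g) = tcirc (iter i ttau f) (j - i) g.
Proof.
elim: i => [|i IH] lt_ij; first by rewrite subn0.
rewrite iterS IH; last by lia.
rewrite ttau_circ; last by rewrite tag_iter_ttau; lia.
by congr tcirc; lia.
Qed.

Lemma ttau_mu : ttau tmu = tmu.
Proof. by rewrite /ttau /= [cyc _ _ _]tau_mu. Qed.

Lemma cup_unitr f : tcup f te = f.
Proof.
rewrite /tcup (@tcircC _ _ tmu 1 f 2) //.
by rewrite /tmu /te tcirc_pack mu1r -/(tid _) tcirc_idl.
Qed.

Lemma cup_unitl f : tcirc (tcirc tmu 2 f) 1 te = f.
Proof.
rewrite -(@tcircC _ _ tmu 1 te 2) //.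
by rewrite /tmu /te tcirc_pack mu1l -/(tid _) tcirc_idl.
Qed.

(** tau (f \cup g) = tau f \circ_m mu (g, -), and the extra codegeneracy plugs the
    unit into the free input of mu. *)
Lemma extra_cup f g : (0 < tag f)%N ->
  textra (tcup f g) = tcirc (ttau f) (tag f) g.
Proof.
move=> f0; have tagm : tag (tcirc tmu 1 f) = (tag f).+1 by [].
rewrite /textra /tcup ttau_circ ?tagm //= ?leqnn ?andbT //.
rewrite ttau_circ1 // ttau_mu.
have -> : tcirc (tcirc (ttau f) (tag f) tmu) (tag f) g =
    tcirc (ttau f) (tag f) (tcirc tmu 1 g).
  by rewrite -tcircA /= ?addn1 ?prednK ?leqnn ?f0.
have -> : (tag f + tag g).-1.+1 = ((tag f).-1 + (tag g).+1)%N by lia.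
by rewrite tcircA ?f0 ?leqnn //= -/(tcup g te) cup_unitr.
Qed.

(** After m - 1 rotations of tau f \circ_m g the operation g sits in slot 1; one
    more makes g the root. When g has no input this last step is not available:
    the arity is then m - 1, so tau^m is the identity, and tau exchanges
    mu (g, -) and mu (-, g). *)
Lemma extra_cupC f g : (0 < tag f)%N ->
  textra (tcup g f) = iter (tag f) ttau (textra (tcup f g)).
Proof.
move=> f0; rewrite [in RHS]extra_cup //.
have [g0|] := posnP (tag g); last first.
  move=> g0; rewrite extra_cup //.
  have -> y : iter (tag f) ttau y = ttau (iter (tag f).-1 ttau y).
    by rewrite -iterS prednK.
  rewrite iter_ttau_circ; last by rewrite /=; lia.
  rewrite (_ : _ - _ = 1)%N; last by lia.
  rewrite ttau_circ1 // ?tag_iter_ttau //.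
  by rewrite -iterS -iterSr prednK // iter_ttau_order.
have -> : iter (tag f) ttau (tcirc (ttau f) (tag f) g) = tcirc (ttau f) (tag f) g.
  rewrite -[RHS]iter_ttau_order; congr (iter _ _ _).
  by rewrite tag_tcirc /=; lia.
have tau_g : ttau (tcirc tmu 1 g) = tcirc tmu 2 g.
  have -> : tcirc tmu 1 g = ttau (tcirc tmu 2 g) by rewrite ttau_circ // ttau_mu.
  rewrite -[RHS]iter_ttau_order.
  by rewrite tag_tcirc g0.
rewrite /textra /tcup g0 ttau_circ1 //.
rewrite tau_g.
have -> : (tag (tcirc (tcirc tmu 1 g) 1 f)).-1.+1 = ((tag f).-1 + 1)%N.
  by rewrite !tag_tcirc g0 /=; lia.
by rewrite tcircA ?f0 ?leqnn //= ?g0 // cup_unitl.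
Qed.

Definition tnormalized x := forall i, (0 < i <= tag x)%N -> tzero (tcirc x i te).

Lemma normalizedP n (f : O n) : reflect (tnormalized (pack f)) (f \in normalized O n).
Proof.
have E j : (codeg j f == 0) <-> tzero (tcirc (pack f) j.+1 te).
  rewrite /tzero tcirc_pack /= /codeg; case: _ / (congr1 _ _) => /=.
  by split=> /eqP.
apply: (iffP forallP) => H.
  by case=> // i lt_in; have := H (Ordinal lt_in); rewrite E.
by move=> j; rewrite E; apply: H => /=.
Qed.

(** Input q of tau^p f is input p + q of f modulo m + 1, where 0 is the root; the
    hypothesis on p + q excludes the root. *)
Lemma tzero_iter_codeg f p q : tnormalized f ->
  (0 < p <= tag f)%N -> (0 < q <= tag f)%N -> (p + q != (tag f).+1)%N ->
  tzero (tcirc (iter p ttau f) q te).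
Proof.
move=> nf le_pf le_qf ne_pq; have [le_pq|lt_pq] := leqP (p + q) (tag f).
  have -> : tcirc (iter p ttau f) q te = iter p ttau (tcirc f (p + q) te).
    by rewrite iter_ttau_circ ?addKn //; lia.
  by rewrite tzero_iter_ttau; apply: nf; lia.
(* Rotating brings the unit to slot 1 of tau^(p + q - 1) f, which is tau^s f since
   tau has order m + 1; slot 1 of tau^s f is slot s + 1 of f. *)
rewrite -(tzero_iter_ttau q.-1) iter_ttau_circ ?tag_iter_ttau; last by lia.
rewrite -iterD (_ : q.-1 + p = (p + q - (tag f).+2) + (tag f).+1)%N; last by lia.
rewrite iterD iter_ttau_order.
set s := (p + q - _)%N.
have -> : tcirc (iter s ttau f) (q - q.-1) te = iter s ttau (tcirc f s.+1 te).
  by rewrite iter_ttau_circ; [congr tcirc; lia | lia].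
by rewrite tzero_iter_ttau; apply: nf; lia.
Qed.

Lemma tnormalized_circ f j g : (0 < j <= tag f)%N ->
  (forall q, (0 < q <= tag f)%N -> q != j -> tzero (tcirc f q te)) ->
  tnormalized g -> tnormalized (tcirc f j g).
Proof.
move=> le_jf nf ng l; rewrite tag_tcirc => le_l.
have [lt_lj|le_jl] := ltnP l j.
  have <- : tcirc (tcirc f l te) (j.-1 + tag te) g = tcirc (tcirc f j g) l te.
    by rewrite tcircC //; lia.
  by apply/tzero_tcircl/nf; lia.
have [lt_l|ge_l] := ltnP l (j + tag g).
  have -> : l = (j.-1 + (l - j).+1)%N by lia.
  by rewrite tcircA //; [apply/tzero_tcircr/ng; lia | lia].
have -> : l = ((l - tag g).+1.-1 + tag g)%N by lia.
by rewrite tcircC; [apply/tzero_tcircl/nf; lia | lia | lia].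
Qed.

Lemma tnormalized_cup f g : tnormalized f -> tnormalized g -> tnormalized (tcup f g).
Proof.
move=> nf ng; apply: tnormalized_circ => //=.
move=> q le_q ne_q.
rewrite -[q]add0n -[0%N]/(1.-1)%N tcircA //=; last by lia.
by apply/tzero_tcircr/nf; lia.
Qed.

Lemma tnormalized_iter_extra_cup f g i : tnormalized f -> tnormalized g ->
  (i < tag f)%N -> tnormalized (iter i ttau (textra (tcup f g))).
Proof.
move=> nf ng lt_if; rewrite extra_cup; last by lia.
rewrite iter_ttau_circ /=; last by lia.
rewrite -iterSr; apply: tnormalized_circ => //; rewrite ?tag_iter_ttau; first by lia.
by move=> q le_q ne_q; apply: tzero_iter_codeg => //; lia.
Qed.

Lemma codeg_linear n j : linear (@codeg k O n j).
Proof. by move=> a f g; rewrite /codeg circ_linearl ocast_linear. Qed.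

Lemma extra_codeg_linear n : linear (@extra_codeg k O n).
Proof. by move=> a f g; rewrite /extra_codeg linearP codeg_linear. Qed.

Lemma iter_linear (V : lmodType k) (u : V -> V) i : linear u -> linear (iter i u).
Proof. by move=> uL; elim: i => [|i IH] a x y //=; rewrite IH uL. Qed.

Lemma iter_cycV_linear n i : linear (iter i (@cycV k O n)).
Proof. by do 2![apply: iter_linear]; apply: linearP. Qed.

End Cyclic.

(** * The Connes coboundary of a cup product *)

Section CupProduct.
Variables (k : comPzRingType) (O : cyclic_operad_mult k).

Lemma pack_cup m n (f : O m) (g : O n) : pack (cup f g) = tcup (pack f) (pack g).
Proof. by []. Qed.

Lemma pack_extra n (f : O n) : pack (extra_codeg f) = textra (pack f).
Proof. by rewrite /extra_codeg /codeg pack_ocast. Qed.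

Lemma cup_linearl m n (g : O n) : linear (fun f : O m => cup f g).
Proof. by move=> a f f'; rewrite /cup circ_linearr circ_linearl. Qed.

Lemma cup_linearr m n (f : O m) : linear (fun g : O n => cup f g).
Proof. by move=> a g g'; rewrite /cup circ_linearr. Qed.

Lemma extra_codeg_cupC m n (f : O m) (g : O n) : (0 < m)%N ->
  extra_codeg (ocast (addnC n m) (cup g f)) =
  iter m (cyc O (m + n).-1) (extra_codeg (cup f g)).
Proof.
move=> m0; apply: pack_inj.
by rewrite -iter_ttau !pack_extra pack_ocast !pack_cup extra_cupC.
Qed.

Lemma iter_cycVK n i j (x : O n) :
  iter i (@cycV k O n) (iter (i + j) (cyc O n) x) = iter j (cyc O n) x.
Proof. by elim: i => // i IH; rewrite iterSr addSn iterS cycK IH. Qed.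

(** The sum defining Z, as a function of the cup product alone and uniform in the
    arity: this form gives linearity and is stable under transport. *)
Definition rotation_sum (s : k) t p (x : O p) : O p.-1 :=
  s *: \sum_(1 <= j < t.+1) (-1) ^+ (j * p.-1) *:
    iter j (@cycV k O p.-1) (extra_codeg x).

Lemma rotation_sum_linear s t p : linear (@rotation_sum s t p).
Proof.
move=> a x y; rewrite /rotation_sum.
under eq_bigr do
  rewrite extra_codeg_linear iter_cycV_linear scalerDr scalerA mulrC -scalerA.
by rewrite big_split /= -scaler_sumr scalerDr !scalerA mulrC.
Qed.

Lemma ZmapE m n (f : O m) (g : O n) :
  Zmap f g = rotation_sum ((-1) ^+ (m * n)) m (ocast (addnC n m) (cup g f)).
Proof. by []. Qed.

Lemma sum_rev_rotation (V : nmodType) m (F : nat -> V) :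
  \sum_(1 <= j < m.+1) F j = \sum_(0 <= i < m) F (m - i)%N.
Proof.
rewrite big_add1 big_nat_rev /=; apply: eq_big_nat => i lt_im.
by congr F; lia.
Qed.

Lemma sum_shift (V : nmodType) m n (F : nat -> V) :
  \sum_(m <= i < m + n) F i = \sum_(0 <= i < n) F (i + m)%N.
Proof. by rewrite -{1}[m]add0n big_addn addKn. Qed.

(** The first m terms of B (f \cup g). *)
Lemma Zmap_extra_cup m n (f : O m) (g : O n) :
  Zmap f g = \sum_(0 <= i < m)
    (-1) ^+ (i * (m + n).-1) *: iter i (cyc O (m + n).-1) (extra_codeg (cup f g)).
Proof.
rewrite /Zmap sum_rev_rotation scaler_sumr; apply: eq_big_nat => i lt_im.
rewrite extra_codeg_cupC; last by lia.
rewrite scalerA -exprD; congr (_ *: _); last first.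
  by rewrite -[RHS](iter_cycVK (m - i)) subnK //; lia.
rewrite -signr_odd -[RHS]signr_odd; congr (_ ^+ nat_of_bool _).
case: m f lt_im => // m _ /andP[_ le_im].
rewrite addSn /= oddD !oddM oddB ?oddD /=; last by lia.
by case: (odd m) (odd n) (odd i) => [] [] [].
Qed.

(** Transport commutes with any construction that is uniform in the arity; this
    turns the sum defining Z (g, f) into one over O (m + n - 1). *)
Lemma ocast_natural (W : forall p, O p -> O p.-1) p q (e : p = q)
    (e' : q.-1 = p.-1) (x : O p) :
  ocast e' (W q (ocast e x)) = W p x.
Proof. by case: q / e in e' *; rewrite (eq_irrelevance e' erefl). Qed.

(** The last n terms of B (f \cup g); here the two signs (-1)^(mn) cancel. *)
Lemma Zmap_swap_extra_cup m n (f : O m) (g : O n) :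
  (-1) ^+ (m * n) *: ocast (congr1 predn (addnC n m)) (Zmap g f) =
  \sum_(m <= i < m + n)
    (-1) ^+ (i * (m + n).-1) *: iter i (cyc O (m + n).-1) (extra_codeg (cup f g)).
Proof.
rewrite ZmapE (ocast_natural (@rotation_sum _ n)) /rotation_sum scalerA.
rewrite -exprD [(n * m)%N]mulnC addnn -signr_odd odd_double scale1r.
rewrite sum_rev_rotation [RHS]sum_shift.
apply: eq_big_nat => i /andP[_ lt_in].
set N := (m + n)%N; have N0 : (0 < N)%N by rewrite /N; lia.
congr (_ *: _).
  rewrite -signr_odd -[RHS]signr_odd; congr (_ ^+ nat_of_bool _).
  rewrite !oddM oddB ?oddD; last by lia.
  rewrite -[odd N.-1]negbK -oddS prednK // oddD.
  by case: (odd m) (odd n) (odd i) => [] [] [].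
rewrite -[RHS](iter_cycVK (n - i)).
rewrite (_ : n - i + (i + m) = N.-1.+1)%N; last by lia.
by rewrite tau_order.
Qed.

Lemma normalized_lin n : linear_closed (normalized O n).
Proof.
move=> a f g /forallP nf /forallP ng; apply/forallP => j.
by rewrite codeg_linear (eqP (nf j)) (eqP (ng j)) scaler0 addr0.
Qed.

Lemma normalized0 n : 0 \in normalized O n.
Proof. by apply/normalizedP => i _; apply: tzero_tcircl. Qed.

Lemma Zmap_normalized m n (f : O m) (g : O n) :
  f \in normalized O m -> g \in normalized O n ->
  Zmap f g \in normalized_pred O (m + n).
Proof.
case: m f => [|m] f nf ng.
  rewrite Zmap_extra_cup big_geq //.
  by case: n {g ng} => [|n] /=; rewrite ?inE ?eqxx //; exact: normalized0.
rewrite Zmap_extra_cup big_nat.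
apply: (big_rec (fun x => x \in normalized O (m + n))) => [|i x lt_im nx].
  exact: normalized0.
apply: normalized_lin => //; apply/normalizedP.
have := tnormalized_iter_extra_cup (normalizedP _ nf) (normalizedP _ ng) lt_im.
by rewrite -pack_cup -pack_extra iter_ttau.
Qed.

End CupProduct.

Theorem lemma1p5 (k : comPzRingType) (O : cyclic_operad_mult k) (m n : nat) :
  (forall (f : O m) (g : O n),
     f \in normalized O m -> g \in normalized O n ->
     cup f g \in normalized O (m + n) /\
     Zmap f g \in normalized_pred O (m + n)) /\
  (forall (a : k) (f f' : O m) (g : O n),
     f \in normalized O m -> f' \in normalized O m -> g \in normalized O n ->
     Zmap (a *: f + f') g = a *: Zmap f g + Zmap f' g) /\
  (forall (a : k) (f : O m) (g g' : O n),
     f \in normalized O m -> g \in normalized O n -> g' \in normalized O n ->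
     Zmap f (a *: g + g') = a *: Zmap f g + Zmap f g') /\
  (forall (f : O m) (g : O n),
     f \in normalized O m -> g \in normalized O n ->
     connesB (cup f g) =
       Zmap f g + (-1) ^+ (m * n) *: ocast (congr1 predn (addnC n m)) (Zmap g f)).
Proof.
split=> [f g nf ng|].
  split; last exact: Zmap_normalized.
  by apply/normalizedP; rewrite pack_cup; apply: tnormalized_cup; apply/normalizedP.
split=> [a f f' g _ _ _|].
  by rewrite !ZmapE cup_linearr ocast_linear rotation_sum_linear.
split=> [a f g g' _ _ _|f g _ _].
  by rewrite !ZmapE cup_linearl ocast_linear rotation_sum_linear.
by rewrite Zmap_extra_cup Zmap_swap_extra_cup -big_cat_nat // leq_addr.
Qed.
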